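(* Let $K/F$ be a cyclic Galois field extension of degree $n\geq 3$, let $m>1$ be an integer with $n\geq m-1$, and let $\sigma_1$ and $\sigma_2$ be any two distinct generators of $\mathrm{Gal}(K/F)$. Let $a_1,a_2\in K\setminus F$ be such that $t^m-a_1\in K[t;\sigma_1]$ and $t^m-a_2\in K[t;\sigma_2]$ are both not right-invariant. Then the $F$-algebras $$K[t;\sigma_1]/K[t;\sigma_1](t^m-a_1)\quad\text{and}\quad K[t;\sigma_2]/K[t;\sigma_2](t^m-a_2)$$ are not isomorphic.
   Context: For a field $K$ and an automorphism $\sigma$ of $K$, $K[t;\sigma]$ is the twisted polynomial ring: polynomials $\sum a_it^i$ with $a_i\in K$, termwise addition and multiplication determined by $ta=\sigma(a)t$ for $a\in K$. It has a right division algorithm: for $g,f$ with $f\neq 0$ there are unique $q,r$ with $g=qf+r$ and $\deg r<\deg f$. For $f\in R=K[t;\sigma]$ of degree $m>1$, the Petit algebra $R/Rf$ is the set of polynomials of degree $<m$ with the multiplication $g\circ h=$ the remainder $r$ of $gh$ in $gh=qf+r$. When $K/F$ is cyclic of degree $n$ with Galois group generated by $\sigma$, $R/Rf$ is a unital (not necessarily associative) $F$-algebra of dimension $mn$. A polynomial $f$ is right-invariant if $fR\subseteq Rf$, i.e. $Rf$ is a two-sided ideal of $R$. Isomorphism means isomorphism of (nonassociative) $F$-algebras. *)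

(* Defs.v *)
From HB Require Import structures.
From mathcomp Require Import all_boot all_order all_algebra all_fingroup.
From mathcomp Require Import all_solvable all_field qpoly.

Set Implicit Arguments.
Unset Strict Implicit.
Unset Printing Implicit Defensive.

Import GRing.Theory.
Local Open Scope ring_scope.

(* K[t; s] lives on the carrier of {poly K}: \sum_i a_i t^i, coefficients on  *)
(* the left, is stored as the polynomial with coefficients a_i.  The alias    *)
(* records s so that the ring structure below does not clash with the         *)
(* commutative one on {poly K}.                                               *)
Definition skewpoly (K : fieldType) (s : {rmorphism K -> K}) : Type := {poly K}.

HB.instance Definition _ (K : fieldType) (s : {rmorphism K -> K}) :=
  GRing.Zmodule.copy (skewpoly s) {poly K}.

Section SkewPolyRing.

Variables (K : fieldType) (s : {rmorphism K -> K}).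
Implicit Types p q r : {poly K}.

(* The left factor a_i t^i acts by a_i t^i q = a_i s^i(q) t^i, where s^i acts *)
(* on the coefficients of q; this is the rule t a = s(a) t, iterated.         *)
Definition skew_mul p q : {poly K} :=
  \sum_(i < size p) p`_i *: (map_poly (iter i s) q * 'X^i).

Fact iter_zmod_morphism i : zmod_morphism (iter i s).
Proof. by elim: i => [|i IH] x y //=; rewrite IH rmorphB. Qed.
Fact iter_monoid_morphism i : monoid_morphism (iter i s).
Proof.
elim: i => [|i [IH1 IHM]]; first by [].
by split=> [|x y] /=; rewrite ?IH1 ?IHM ?rmorph1 ?rmorphM.
Qed.
Definition skew_iter i : K -> K := iter i s.
HB.instance Definition _ i :=
  GRing.isZmodMorphism.Build K K (skew_iter i) (iter_zmod_morphism i).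
HB.instance Definition _ i :=
  GRing.isMonoidMorphism.Build K K (skew_iter i) (iter_monoid_morphism i).

Lemma skew_mulE n p q : (size p <= n)%N ->
  skew_mul p q = \sum_(i < n) p`_i *: (map_poly (skew_iter i) q * 'X^i).
Proof.
move=> le_pn; rewrite /skew_mul.
rewrite (big_ord_widen n (fun i => p`_i *: (map_poly (iter i s) q * 'X^i))) //.
rewrite big_mkcond /=; apply: eq_bigr => i _.
by case: ltnP => // le_pi; rewrite nth_default ?scale0r.
Qed.

Lemma skew_mulDl : left_distributive skew_mul +%R.
Proof.
move=> p q r; set n := maxn (size p) (size q).
rewrite !(@skew_mulE n) ?leq_maxl ?leq_maxr ?size_polyD // -big_split /=.
by apply: eq_bigr => i _; rewrite coefD scalerDl.
Qed.

Lemma skew_mulDr : right_distributive skew_mul +%R.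
Proof.
move=> p q r; rewrite !(@skew_mulE (size p)) // -big_split /=.
by apply: eq_bigr => i _; rewrite rmorphD mulrDl scalerDr.
Qed.

Lemma skew_mul0l q : skew_mul 0 q = 0.
Proof. by rewrite /skew_mul size_poly0 big_ord0. Qed.

Lemma skew_mul0r p : skew_mul p 0 = 0.
Proof.
rewrite (@skew_mulE (size p)) // big1 // => i _.
by rewrite rmorph0 mul0r scaler0.
Qed.

Lemma skew_mulZX a i q :
  skew_mul (a *: 'X^i) q = a *: (map_poly (skew_iter i) q * 'X^i).
Proof.
rewrite (@skew_mulE i.+1); last first.
  by rewrite (leq_trans (size_scale_leq _ _)) // size_polyXn.
rewrite big_ord_recr /= big1 ?add0r => [|j _].
  by rewrite coefZ coefXn eqxx mulr1.
by rewrite coefZ coefXn (ltn_eqF (ltn_ord j)) mulr0 scale0r.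
Qed.

Lemma skew_mul_suml n (E : 'I_n -> {poly K}) q :
  skew_mul (\sum_(i < n) E i) q = \sum_(i < n) skew_mul (E i) q.
Proof.
exact: (big_morph (skew_mul^~ q) (fun x y => skew_mulDl x y q) (skew_mul0l q)).
Qed.

Lemma skew_mul_sumr n p (E : 'I_n -> {poly K}) :
  skew_mul p (\sum_(i < n) E i) = \sum_(i < n) skew_mul p (E i).
Proof. exact: (big_morph (skew_mul p) (skew_mulDr p) (skew_mul0r p)). Qed.

Lemma skew_iterD i j x : skew_iter i (skew_iter j x) = skew_iter (i + j) x.
Proof. by rewrite /skew_iter iterD. Qed.

Lemma skew_mul_expl p q :
  skew_mul p q = \sum_(i < size p) skew_mul (p`_i *: 'X^i) q.
Proof. by rewrite -skew_mul_suml -poly_def coefK. Qed.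

Lemma skew_mul_expr p q :
  skew_mul p q = \sum_(i < size q) skew_mul p (q`_i *: 'X^i).
Proof. by rewrite -skew_mul_sumr -poly_def coefK. Qed.

Lemma skew_mulA : associative skew_mul.
Proof.
move=> p q r; rewrite skew_mul_expl [in RHS](skew_mul_expl p q) skew_mul_suml.
apply: eq_bigr => i _.
rewrite [in LHS](skew_mul_expl q r) skew_mul_sumr [in RHS](skew_mul_expr _ q).
rewrite skew_mul_suml; apply: eq_bigr => j _.
rewrite !skew_mulZX !map_polyZ !rmorphM /= !map_polyXn -!scalerAl -!mulrA.
rewrite -!exprD scalerA [(j + i)%N]addnC scalerA skew_mulZX -map_poly_comp.
congr (_ *: (_ * _)); apply: eq_map_poly => x /=; exact: skew_iterD.
Qed.

Lemma skew_mul1l : left_id 1 skew_mul.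
Proof.
move=> q; rewrite -[1]scale1r -(expr0 'X) skew_mulZX scale1r expr0 mulr1.
by rewrite map_poly_id.
Qed.

Lemma skew_mul1r : right_id 1 skew_mul.
Proof.
move=> p; rewrite (@skew_mulE (size p)) // -[RHS]coefK poly_def.
by apply: eq_bigr => i _; rewrite rmorph1 mul1r.
Qed.

End SkewPolyRing.

HB.instance Definition _ (K : fieldType) (s : {rmorphism K -> K}) :=
  GRing.Zmodule_isNzRing.Build (skewpoly s)
    (@skew_mulA K s) (@skew_mul1l K s) (@skew_mul1r K s)
    (@skew_mulDl K s) (@skew_mulDr K s) (oner_neq0 {poly K}).

Section SkewPolyTheory.

Variables (K : fieldType) (s : {rmorphism K -> K}).
Implicit Types (f g q r : skewpoly s) (p : {poly K}).

Definition skewC (a : K) : skewpoly s := a%:P.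
Definition skewX : skewpoly s := 'X.
Definition skew_size f : nat := size (f : {poly K}).
Definition skew_lead f : K := lead_coef (f : {poly K}).

Lemma skewCM a f : skewC a * f = a *: (f : {poly K}).
Proof.
rewrite -[skewC a]alg_polyC -(expr0 'X) [LHS]skew_mulZX expr0 mulr1.
by rewrite map_poly_id.
Qed.

Lemma skewXM f : skewX * f = map_poly s (f : {poly K}) * 'X.
Proof.
have -> : skewX = 1 *: 'X^1 :> {poly K} by rewrite scale1r expr1.
by rewrite [LHS]skew_mulZX scale1r expr1.
Qed.

Lemma skewX_mulC a : skewX * skewC a = skewC (s a) * skewX.
Proof. by rewrite skewXM skewCM map_polyC mul_polyC. Qed.

Lemma skewXn i : skewX ^+ i = 'X^i :> {poly K}.
Proof.
elim: i => [|i IH]; first by [].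
by rewrite exprS skewXM IH map_polyXn -exprSr.
Qed.

Lemma skewpolyE f :
  f = \sum_(i < skew_size f) skewC (f : {poly K})`_i * skewX ^+ i.
Proof.
rewrite -[LHS](coefK (f : {poly K})) poly_def; apply: eq_bigr => i _.
by rewrite skewCM skewXn.
Qed.

(* Right division: each step cancels the leading term of g by subtracting     *)
(* a t^d f, whose leading coefficient is a s^d(lead f).                       *)
Fixpoint skew_rem_rec (k : nat) g f : skewpoly s :=
  if (skew_size g < skew_size f)%N then g
  else if k is k'.+1 then
    let d := (skew_size g - skew_size f)%N in
    let a := skew_lead g / iter d s (skew_lead f) in
    skew_rem_rec k' (g - skewC a * skewX ^+ d * f) f
  else g.

Definition skew_rem g f : skewpoly s := skew_rem_rec (skew_size g) g f.

Lemma iter0_skew i : iter i s 0 = 0.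
Proof. exact: (rmorph0 (skew_iter s i)). Qed.

Lemma iter_skew_eq0 i x : (iter i s x == 0) = (x == 0).
Proof. exact: (fmorph_eq0 (skew_iter s i)). Qed.

Lemma coef_skew_mul (p1 p2 : {poly K}) k :
  (skew_mul s p1 p2)`_k =
  \sum_(i < size p1) if (k < i)%N then 0 else p1`_i * iter i s p2`_(k - i).
Proof.
rewrite /skew_mul coef_sum; apply: eq_bigr => i _.
rewrite coefZ coefMXn; case: ifP => _; rewrite ?mulr0 //.
by rewrite (coef_map (skew_iter s i)).
Qed.

Lemma skew_mul_lead (p1 p2 : {poly K}) : p1 != 0 -> p2 != 0 ->
  (skew_mul s p1 p2)`_((size p1).-1 + (size p2).-1) =
  lead_coef p1 * iter (size p1).-1 s (lead_coef p2).
Proof.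
move=> nz1 nz2; rewrite coef_skew_mul.
have sz1: (0 < size p1)%N by rewrite size_poly_gt0.
rewrite -[in \sum_(_ < _) _](prednK sz1) big_ord_recr /= big1 ?add0r.
  by rewrite ltnNge leq_addr addKn.
move=> i _; rewrite ltnNge (leq_trans (ltnW (ltn_ord i)) (leq_addr _ _)) /=.
rewrite [p2`__]nth_default ?iter0_skew ?mulr0 //.
rewrite leq_subRL ?(leq_trans (ltnW (ltn_ord i)) (leq_addr _ _)) //.
by rewrite -[X in (_ + X <= _)%N](prednK (_ : 0 < size p2)%N) ?size_poly_gt0 //
  addnS -addSn leq_add2r.
Qed.

Lemma size_skew_mul (p1 p2 : {poly K}) : p1 != 0 -> p2 != 0 ->
  size (skew_mul s p1 p2) = (size p1 + size p2).-1.
Proof.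
move=> nz1 nz2.
have [sz1 sz2]: (0 < size p1)%N /\ (0 < size p2)%N by rewrite !size_poly_gt0.
apply/eqP; rewrite eqn_leq; apply/andP; split.
  apply/leq_sizeP => k le_k; rewrite coef_skew_mul big1 // => i _.
  case: ltnP => // le_ik; rewrite [p2`__]nth_default ?iter0_skew ?mulr0 //.
  rewrite leq_subRL //; apply: leq_trans le_k.
  by rewrite -ltnS prednK ?ltn_add2r ?addn_gt0 ?sz1.
have -> : (size p1 + size p2).-1 = ((size p1).-1 + (size p2).-1).+1.
  by rewrite -addnS prednK // -subn1 -subn1 addnBAC.
rewrite ltnNge; apply/negP => le_sz; have := skew_mul_lead nz1 nz2.
rewrite nth_default // => /esym/eqP; rewrite mulf_eq0 lead_coef_eq0 (negPf nz1).
by rewrite iter_skew_eq0 lead_coef_eq0 (negPf nz2).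
Qed.

Lemma skew_rem_recP k g f : f != 0 -> (skew_size g <= k)%N ->
  (exists q, g = q * f + skew_rem_rec k g f) /\
  (skew_size (skew_rem_rec k g f) < skew_size f)%N.
Proof.
move=> nzf; have sf: (0 < skew_size f)%N by rewrite /skew_size size_poly_gt0.
elim: k g => [|k IH] g.
  rewrite leqn0 => /eqP g0 /=; rewrite g0 sf; split; last by rewrite g0.
  by exists 0; rewrite mul0r add0r.
move=> le_g /=; case: ltnP => [lt_gf|le_fg].
  by split=> //; exists 0; rewrite mul0r add0r.
have nzg: g != 0 by rewrite -size_poly_gt0 (leq_trans sf).
set d := (_ - _)%N; set a := _ / _; set c := skewC a * skewX ^+ d.
have [|[q def_g] lt_r] := IH (g - c * f); last first.
- split=> //; exists (q + c).
  by rewrite mulrDl addrAC -def_g subrK.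
have nzlf: iter d s (skew_lead f) != 0.
  by rewrite iter_skew_eq0 lead_coef_eq0.
have nza: a != 0 by rewrite mulf_neq0 ?invr_neq0 ?lead_coef_eq0.
have cE: c = a *: 'X^d :> {poly K} by rewrite /c skewCM skewXn.
have sc: size (a *: 'X^d : {poly K}) = d.+1 by rewrite size_scale // size_polyXn.
have nzc: (a *: 'X^d : {poly K}) != 0 by rewrite -size_poly_gt0 sc.
have scf: size (c * f : {poly K}) = size (g : {poly K}).
  by rewrite [c * f]/(skew_mul s c f) cE size_skew_mul // sc addSn /= subnK.
rewrite -ltnS (leq_trans _ le_g) //.
have eq_lead: lead_coef (c * f : {poly K}) = lead_coef (g : {poly K}).
  rewrite lead_coefE scf.
  have -> : (size (g : {poly K})).-1 =
      ((size (a *: 'X^d : {poly K})).-1 + (size (f : {poly K})).-1)%N.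
    by rewrite sc /= -subn1 -subn1 addnBA // subnK.
  rewrite [c * f]/(skew_mul s c f) cE skew_mul_lead // sc.
  by rewrite lead_coefZ lead_coefXn mulr1 divfK.
have sg: (0 < size (g : {poly K}))%N by rewrite size_poly_gt0.
rewrite /skew_size -(prednK sg) ltnS; apply/leq_sizeP => j le_j.
have -> : (g - c * f : {poly K})`_j = (g : {poly K})`_j - (c * f : {poly K})`_j.
  exact: coefB.
move: le_j; rewrite leq_eqVlt => /orP[/eqP <-|].
  by rewrite -[X in _ - _`_X.-1]scf -!lead_coefE eq_lead subrr.
by rewrite prednK // => lt_j; rewrite !nth_default ?scf // subrr.
Qed.

Lemma skew_remP g f : f != 0 ->
  (exists q, g = q * f + skew_rem g f) /\
  (skew_size (skew_rem g f) < skew_size f)%N.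
Proof. by move=> nzf; apply: skew_rem_recP. Qed.

Lemma skew_rem_uniq f q q' r r' : f != 0 ->
    (skew_size r < skew_size f)%N -> (skew_size r' < skew_size f)%N ->
  q * f + r = q' * f + r' -> q = q' /\ r = r'.
Proof.
move=> nzf lt_r lt_r' eq_qr.
have: (q - q') * f = r' - r.
  by rewrite mulrBl; apply/eqP; rewrite subr_eq addrAC [r' + _]addrC -eq_qr addrK.
have [/eqP|nz_q] := eqVneq (q - q') 0.
  rewrite subr_eq0 => /eqP eq_q _; split=> //.
  by apply: (addrI (q' * f)); rewrite -eq_qr eq_q.
move=> eq_r; suff: (skew_size ((q - q') * f)%R < skew_size f)%N.
  rewrite /skew_size [(q - q') * f]/(skew_mul s (q - q') f) size_skew_mul //.
  have sq: (0 < size ((q - q')%R : {poly K}))%N by rewrite size_poly_gt0.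
  by rewrite -(prednK sq) addSn /= ltnNge leq_addl.
rewrite eq_r /skew_size (leq_ltn_trans (size_polyD _ _)) //.
by rewrite gtn_max size_polyN -/(skew_size r) -/(skew_size r') lt_r lt_r'.
Qed.

Definition right_invariant f : Prop :=
  forall g, exists h, f * g = h * f.

End SkewPolyTheory.

Section PetitAlgebra.

Variables (F : fieldType) (K : fieldExtType F) (s : {rmorphism K -> K}).

(* The carrier of R/Rf: polynomials of degree < deg f, as deg f = size f - 1. *)
(* It is an alias because {poly_n K} carries the K-module structure, whereas  *)
(* R/Rf is regarded as an F-module.                                           *)
Definition petit (f : skewpoly s) : Type := {poly_(skew_size f).-1 K}.

HB.instance Definition _ (f : skewpoly s) :=
  GRing.Zmodule.copy (petit f) {poly_(skew_size f).-1 K}.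

Variable f : skewpoly s.

Definition petit_scale (c : F) (g : petit f) : petit f :=
  c%:A *: (g : {poly_(skew_size f).-1 K}).

Fact petit_scaleA a b g :
  petit_scale a (petit_scale b g) = petit_scale (a * b) g.
Proof. by rewrite /petit_scale scalerA -scalerAl mul1r scalerA. Qed.
Fact petit_scale1 : left_id 1 petit_scale.
Proof. by move=> g; rewrite /petit_scale !scale1r. Qed.
Fact petit_scaleDr : right_distributive petit_scale +%R.
Proof. by move=> c g h; rewrite /petit_scale scalerDr. Qed.
Fact petit_scaleDl g : {morph petit_scale^~ g : a b / a + b}.
Proof. by move=> a b; rewrite /petit_scale !scalerDl. Qed.

HB.instance Definition _ := GRing.Zmodule_isLmodule.Build F (petit f)
  petit_scaleA petit_scale1 petit_scaleDr petit_scaleDl.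

Definition petit_val (g : petit f) : skewpoly s :=
  polyn (g : {poly_(skew_size f).-1 K}).

Definition petit_mul (g h : petit f) : petit f :=
  npolyp _ (skew_rem (petit_val g * petit_val h) f).

(* For f != 0 the truncation done by npolyp is void. *)
Lemma petit_mulE g h : f != 0 ->
  petit_val (petit_mul g h) = skew_rem (petit_val g * petit_val h) f.
Proof.
move=> nzf; apply: npolypK; rewrite -ltnS prednK ?size_poly_gt0 //.
by case: (skew_remP (petit_val g * petit_val h) nzf).
Qed.

End PetitAlgebra.

Arguments petit_mul {F K s} f g h.

(* Isomorphism of nonassociative F-algebras, each given by its underlying     *)
(* F-module and its multiplication; preservation of units is automatic.       *)
Definition nalg_isomorphic (F : fieldType) (A B : lmodType F)
    (mulA : A -> A -> A) (mulB : B -> B -> B) : Prop :=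
  exists phi : {linear A -> B},
    bijective phi /\ {morph phi : x y / mulA x y >-> mulB x y}.

(* Main.v *)
From HB Require Import structures.
Require Import Defs.
From mathcomp Require Import all_boot all_order all_algebra all_fingroup.
From mathcomp Require Import all_solvable all_field.

(** Write A_i for the Petit algebra of f_i = t^m - a_i in K[t; s_i], and suppose
    that phi : A_1 -> A_2 is an isomorphism.  Everything is read off from the
    associators [x, y, z] = (xy)z - x(yz), whose vanishing phi preserves.  If the
    product of x and y in K[t; s] is q f + r with deg r < m, then (xy)z - x(yz)
    is congruent to - q f z modulo the left ideal R f, so [x, y, -] = 0 exactly
    when q f R is contained in R f ([associator_vanishesP]).  This has two
    consequences when f is not right-invariant.

    - If x is not a constant, multiplying it by a suitable power of t makes q a
      nonzero constant; hence the left nucleus consists of the constants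
      ([left_nucleus_const]), and phi restricts to an automorphism tau of K.

    - If x = c t^i and y = d t^j with i + j >= m, then q = b t^(i+j-m).  Left
      multiplication by t is injective on R/Rf because a <> 0, so t^e can be
      cancelled from t^e f R <= R f, and [x, y, -] is again nonzero
      ([associator_vanishes_monomial]).

    Let T = phi(t).  From t c = s_1(c) t one gets, on the coefficient T_j,
    T_j s_2^j(tau c) = tau(s_1 c) T_j.  The Galois group being abelian, T_j <> 0
    forces s_2^j = s_1.  As s_1 <> 1 and j < m <= n + 1, this singles out one j
    in 1, ..., n - 1, so T = k t^j.  Moreover j >= 2 since s_1 <> s_2.

    In A_1 the associators [t, t^i, -] vanish as long as i + 1 < m.  Transporting
    this to A_2, induction on i shows phi(t^i) = c_i t^(i j) without any reduction
    modulo f_2, that is i j < m for all i < m ([iso_X_monomial_degree]).  For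
    i = m - 1 this gives (m - 1) j < m, which is absurd when m, j >= 2. *)

Set Implicit Arguments.
Unset Strict Implicit.
Unset Printing Implicit Defensive.

Import GRing.Theory.
Local Open Scope ring_scope.

(** * Skew polynomials and the left ideal R f *)

Section SkewPolynomials.

Variables (K : fieldType) (s : {rmorphism K -> K}).
Implicit Types f g h q r : skewpoly s.

Lemma skew_size_gt0 g : (0 < skew_size g)%N = (g != 0).
Proof. exact: size_poly_gt0. Qed.

Lemma skew_sizeM g h : g != 0 -> h != 0 ->
  skew_size (g * h) = (skew_size g + skew_size h).-1.
Proof. exact: size_skew_mul. Qed.

Lemma skew_mulf_neq0 g h : g != 0 -> h != 0 -> g * h != 0.
Proof.
move=> nzg nzh; rewrite -skew_size_gt0 skew_sizeM //.
rewrite -!skew_size_gt0 in nzg nzh.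
by rewrite -(prednK nzg) -(prednK nzh) addnS.
Qed.

Lemma skew_sizeB g h n :
  (skew_size g <= n)%N -> (skew_size h <= n)%N -> (skew_size (g - h)%R <= n)%N.
Proof.
move=> le_g le_h; rewrite /skew_size (leq_trans (size_polyD _ _)) //.
by rewrite geq_max size_polyN; apply/andP.
Qed.

Lemma skewC0 : skewC s 0 = 0.
Proof. exact: polyC0. Qed.

Lemma skewCM_morph a b : skewC s (a * b) = skewC s a * skewC s b.
Proof. by rewrite skewCM [LHS]polyCM mul_polyC. Qed.

Lemma skew_size1P g : reflect (exists a, g = skewC s a) (skew_size g <= 1)%N.
Proof.
apply: (iffP idP) => [/size1_polyC -> | [a ->]]; last exact: size_polyC_leq1.
by exists (g : {poly K})`_0.
Qed.

Lemma skew_monomialE a i :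
  skewC s a * skewX s ^+ i = a *: 'X^i :> {poly K}.
Proof. by rewrite skewCM skewXn. Qed.

Lemma skew_size_monomial a i : a != 0 ->
  skew_size (skewC s a * skewX s ^+ i) = i.+1.
Proof.
by move=> nza; rewrite /skew_size skew_monomialE size_scale // size_polyXn.
Qed.

Lemma skew_sizeXn i : skew_size (skewX s ^+ i) = i.+1.
Proof. by rewrite /skew_size skewXn size_polyXn. Qed.

Lemma skewXn_mulC a i :
  skewX s ^+ i * skewC s a = skewC s (iter i s a) * skewX s ^+ i.
Proof.
elim: i => [|i IH]; first by rewrite !expr0 mulr1 mul1r.
by rewrite exprS -mulrA IH mulrA skewX_mulC -mulrA -exprS.
Qed.

Lemma skew_monomialM a b i j :
  skewC s a * skewX s ^+ i * (skewC s b * skewX s ^+ j)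
  = skewC s (a * iter i s b) * skewX s ^+ (i + j).
Proof.
rewrite -mulrA [skewX s ^+ i * _]mulrA skewXn_mulC skewCM_morph exprD.
by rewrite !mulrA.
Qed.

Lemma coef_skewCM a g i :
  (skewC s a * g : {poly K})`_i = a * (g : {poly K})`_i.
Proof. by rewrite skewCM coefZ. Qed.

Lemma coef_skewMC g a i :
  (g * skewC s a : {poly K})`_i = (g : {poly K})`_i * iter i s a.
Proof.
rewrite [g * _]/(skew_mul s g (skewC s a)) coef_skew_mul.
have [lt_i|le_i] := ltnP i (size (g : {poly K})); last first.
  rewrite [RHS](_ : _ = 0) ?nth_default ?mul0r // big1 // => j _.
  case: ltnP => // le_ji; rewrite coefC subn_eq0 leqNgt.
  by rewrite (leq_trans (ltn_ord j) le_i) /= iter0_skew mulr0.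
rewrite (bigD1 (Ordinal lt_i)) //= ltnn subnn coefC /= big1 ?addr0 // => j nji.
case: ltnP => // le_ji; rewrite coefC subn_eq0 leq_eqVlt.
rewrite [i == _](_ : _ = false) ?ltnNge ?le_ji /= ?iter0_skew ?mulr0 //.
by apply/eqP => eq_ij; case/eqP: nji; apply/val_inj.
Qed.

Definition in_left_ideal f g := exists q, g = q * f.

Lemma in_left_idealD f g h :
  in_left_ideal f g -> in_left_ideal f h -> in_left_ideal f (g + h).
Proof. by case=> q -> [p ->]; exists (q + p); rewrite mulrDl. Qed.

Lemma in_left_idealB f g h :
  in_left_ideal f g -> in_left_ideal f h -> in_left_ideal f (g - h).
Proof. by case=> q -> [p ->]; exists (q - p); rewrite mulrBl. Qed.

Lemma in_left_idealM f g h : in_left_ideal f h -> in_left_ideal f (g * h).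
Proof. by case=> q ->; exists (g * q); rewrite mulrA. Qed.

Lemma in_left_idealCM f c g : c != 0 ->
  in_left_ideal f (skewC s c * g) -> in_left_ideal f g.
Proof.
move=> nzc /(in_left_idealM (skewC s c^-1)); rewrite mulrA -skewCM_morph.
by rewrite mulVf // [skewC s 1]/(1 : skewpoly s) mul1r.
Qed.

Lemma skew_rem_sub f g : f != 0 -> in_left_ideal f (g - skew_rem g f).
Proof.
by move=> nzf; have [[q def_g] _] := skew_remP g nzf; exists q;
  rewrite {1}def_g addrK.
Qed.

Lemma skew_size_rem f g : f != 0 -> (skew_size (skew_rem g f) < skew_size f)%N.
Proof. by move=> nzf; case: (skew_remP g nzf). Qed.

Lemma skew_remE f q r : f != 0 ->
  (skew_size r < skew_size f)%N -> skew_rem (q * f + r) f = r.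
Proof.
move=> nzf lt_r; have [[q' def_g] lt_r'] := skew_remP (q * f + r) nzf.
by have [] := skew_rem_uniq nzf lt_r lt_r' def_g.
Qed.

Lemma skew_rem_id f g : f != 0 ->
  (skew_size g < skew_size f)%N -> skew_rem g f = g.
Proof. by move=> nzf lt_g; rewrite -{1}[g]add0r -(mul0r f) skew_remE. Qed.

Lemma eq_skew_rem f g h : f != 0 ->
  skew_rem g f = skew_rem h f <-> in_left_ideal f (g - h).
Proof.
move=> nzf; split=> [eq_gh | [q /eqP]].
  have := in_left_idealB (skew_rem_sub g nzf) (skew_rem_sub h nzf).
  by rewrite eq_gh opprB addrA subrK.
rewrite subr_eq => /eqP ->; have [[p def_h] lt_r] := skew_remP h nzf.
by rewrite {1}def_h addrA -mulrDl skew_remE.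
Qed.

End SkewPolynomials.

(** * Cancelling powers of t modulo t^m - a *)

Section Binomial.

Variables (K : fieldType) (s : {rmorphism K -> K}) (m : nat) (a : K).
Hypothesis m_gt0 : (0 < m)%N.
Implicit Types g r : skewpoly s.

Let f : skewpoly s := skewX s ^+ m - skewC s a.

Lemma skew_size_binomial : skew_size f = m.+1.
Proof.
rewrite /skew_size /f skewXn [LHS]size_polyDl size_polyXn //.
by rewrite size_polyN (leq_ltn_trans (size_polyC_leq1 a)).
Qed.

Lemma binomial_neq0 : f != 0.
Proof. by rewrite -skew_size_gt0 skew_size_binomial. Qed.

Lemma coef0_binomial : (f : {poly K})`_0 = - a.
Proof.
rewrite /f skewXn -[LHS]/(('X^m - a%:P : {poly K})`_0) coefB coefXn coefC.
by rewrite eqxx -(prednK m_gt0) sub0r.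
Qed.

Hypothesis nza : a != 0.

(** It suffices to treat remainders r modulo f.  For deg r < m, a relation
    t r = c f leaves only a constant c, since deg (t r) <= m = deg f.  The
    constant terms then give 0 = - c a, so r = 0. *)
Lemma left_ideal_X_cancel g :
  in_left_ideal f (skewX s * g) -> in_left_ideal f g.
Proof.
have nzf := binomial_neq0.
have [[q def_g] lt_r] := skew_remP g nzf; set r := skew_rem g f in def_g lt_r.
move=> Xg_f; exists q; rewrite def_g; suff ->: r = 0 by rewrite addr0.
have: in_left_ideal f (skewX s * r).
  rewrite -[r](addKr (q * f)) -def_g addrC mulrBr; apply: in_left_idealB => //.
  by apply: in_left_idealM; exists q.
case=> c Xr; apply/eqP/idPn => nzr.
have nzX : skewX s != 0 by rewrite -skew_size_gt0 /skew_size size_polyX.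
have nzc : c != 0.
  by apply: contraTneq (skew_mulf_neq0 nzX nzr) => c0; rewrite Xr c0 mul0r eqxx.
have/skew_size1P[b def_c]: (skew_size c <= 1)%N.
  have := congr1 (@skew_size K s) Xr; rewrite !skew_sizeM //.
  rewrite {1}/skew_size size_polyX skew_size_binomial addnS /= add1n => def_r.
  by rewrite -(leq_add2r m) add1n -def_r -skew_size_binomial.
move: Xr nzc; rewrite {}def_c skewXM => /(congr1 (fun p : {poly K} => p`_0)).
rewrite coefMX coef_skewCM coef0_binomial /= => /esym/eqP.
rewrite mulf_eq0 oppr_eq0 (negPf nza) orbF => /eqP ->.
by rewrite skewC0 eqxx.
Qed.

Lemma left_ideal_monomial_cancel c e g : c != 0 ->
  in_left_ideal f (skewC s c * skewX s ^+ e * g) -> in_left_ideal f g.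
Proof.
move=> nzc; rewrite -mulrA => /(in_left_idealCM nzc).
elim: e => [|e IH]; first by rewrite mul1r.
by rewrite exprS -mulrA => /left_ideal_X_cancel.
Qed.

End Binomial.

(** * Associators in a Petit algebra *)

Section Petit.

Variables (F : fieldType) (K : fieldExtType F) (s : {rmorphism K -> K}).
Variable f : skewpoly s.
Hypothesis nzf : f != 0.
Implicit Types (x y z : petit f) (g h k : skewpoly s).

Let le_size g :
  (skew_size g <= (skew_size f).-1)%N = (skew_size g < skew_size f)%N.
Proof. by rewrite -ltnS prednK ?skew_size_gt0. Qed.

(** On polynomials of degree at least deg f this is truncation, not reduction
    modulo f; it is meant for polynomials of degree less than deg f. *)
Definition to_petit g : petit f := npolyp _ g.

Lemma to_petitK g : (skew_size g < skew_size f)%N -> petit_val (to_petit g) = g.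
Proof. by rewrite -le_size => le_g; apply: npolypK. Qed.

Lemma petit_val_inj : injective (@petit_val F K s f).
Proof. exact: val_inj. Qed.

Lemma petit_valK x : to_petit (petit_val x) = x.
Proof.
apply: petit_val_inj; rewrite to_petitK // -le_size; exact: size_npoly.
Qed.

Lemma petit_valD x y : petit_val (x + y) = petit_val x + petit_val y.
Proof. by []. Qed.

Lemma petit_valZ c x : petit_val (c *: x) = skewC s c%:A * petit_val x.
Proof. by rewrite skewCM. Qed.

Lemma petit_size x : (skew_size (petit_val x) < skew_size f)%N.
Proof. by rewrite -le_size; exact: size_npoly. Qed.

Definition associator_vanishes x y :=
  forall z, petit_mul f (petit_mul f x y) z = petit_mul f x (petit_mul f y z).

(** Modulo the left ideal R f, x(yz) is the product of x, y and z in K[t; s],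
    because changing yz by an element of R f changes x(yz) by one.  On the other
    side (xy)z is r z, and r = xy - q f.  The difference is therefore - q f z.  It
    depends on z modulo R f only up to q f R f, which lies in R f, so that all
    skew polynomials k may be tested instead of the remainders z. *)
Lemma associator_vanishesP x y q r :
    petit_val x * petit_val y = q * f + r ->
    (skew_size r < skew_size f)%N ->
  associator_vanishes x y <-> (forall k, in_left_ideal f (q * f * k)).
Proof.
move=> def_xy lt_r.
have key k : petit_mul f (petit_mul f x y) (to_petit (skew_rem k f))
    = petit_mul f x (petit_mul f y (to_petit (skew_rem k f)))
    <-> in_left_ideal f (q * f * k).
  have Ek : in_left_ideal f (k - skew_rem k f) by apply: skew_rem_sub.
  set k' := skew_rem k f in Ek *; have lt_k' : (skew_size k' < skew_size f)%N.
    exact: skew_size_rem.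
  have -> : q * f * k = q * f * (k - k') + q * f * k' by rewrite -mulrDr subrK.
  have E1 : in_left_ideal f (q * f * (k - k')) by apply: in_left_idealM.
  have yk' := skew_rem_sub (petit_val y * k') nzf.
  have E2 : in_left_ideal f (petit_val x * (petit_val y * k' -
      skew_rem (petit_val y * k') f)) by apply: in_left_idealM.
  have E3 : r * k' - petit_val x * skew_rem (petit_val y * k') f
     = petit_val x * (petit_val y * k' - skew_rem (petit_val y * k') f)
       - q * f * k'.
    by rewrite mulrBr mulrA def_xy mulrDl [RHS]addrC -addrA addKr.
  have E0 : petit_mul f (petit_mul f x y) (to_petit k')
      = petit_mul f x (petit_mul f y (to_petit k'))
      <-> in_left_ideal f
            (r * k' - petit_val x * skew_rem (petit_val y * k') f).
    apply: iff_trans (eq_skew_rem _ _ nzf).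
    have val_l : petit_val (petit_mul f (petit_mul f x y) (to_petit k'))
        = skew_rem (r * k') f.
      by rewrite !petit_mulE // to_petitK // def_xy skew_remE.
    have val_r : petit_val (petit_mul f x (petit_mul f y (to_petit k')))
        = skew_rem (petit_val x * skew_rem (petit_val y * k') f) f.
      by rewrite !petit_mulE // to_petitK.
    by rewrite -val_l -val_r; split=> [-> | /petit_val_inj].
  apply: iff_trans E0 _.
  rewrite E3; split=> [E4 | E4]; last first.
    apply: in_left_idealB => //.
    rewrite -[q * f * k'](addKr (q * f * (k - k'))) addrC.
    exact: in_left_idealB.
  apply: in_left_idealD => //.
  have := in_left_idealB E2 E4; by rewrite opprB addrC subrK.
split=> [xy0 k|xy0 z]; first by apply/key.
rewrite -(petit_valK z) -(skew_rem_id nzf (petit_size z)).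
by apply/key.
Qed.

Lemma associator_vanishes_small x y :
    (skew_size (petit_val x * petit_val y)%R < skew_size f)%N ->
  associator_vanishes x y.
Proof.
move=> lt_xy; have def_xy : petit_val x * petit_val y
  = 0 * f + petit_val x * petit_val y by rewrite mul0r add0r.
by apply/(associator_vanishesP def_xy lt_xy) => k; exists 0; rewrite !mul0r.
Qed.

Lemma petit_mul_small g h :
    (skew_size g < skew_size f)%N -> (skew_size h < skew_size f)%N ->
    (skew_size (g * h)%R < skew_size f)%N ->
  petit_mul f (to_petit g) (to_petit h) = to_petit (g * h).
Proof.
move=> lt_g lt_h lt_gh; apply: petit_val_inj.
by rewrite petit_mulE // !to_petitK // skew_rem_id.
Qed.

Lemma const_associator_vanishes x y :
  (skew_size (petit_val x) <= 1)%N -> associator_vanishes x y.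
Proof.
move=> /skew_size1P[c val_x]; apply: associator_vanishes_small.
rewrite val_x skewCM.
exact: leq_ltn_trans (size_scale_leq _ _) (petit_size y).
Qed.

(** Multiplying x by t^(deg f - deg x) gives a product of the same degree as f,
    whose quotient by f is a nonzero constant c; then c f R <= R f, which says
    that f is right-invariant. *)
Lemma left_nucleus_const x : (1 < skew_size f)%N -> ~ right_invariant f ->
  (forall y, associator_vanishes x y) -> (skew_size (petit_val x) <= 1)%N.
Proof.
move=> f_gt1 notRI nuc_x.
rewrite leqNgt; apply/negP => x_gt1; apply: notRI => k.
(* A size is one more than the degree, so the difference is that of degrees. *)
pose d := (skew_size f - skew_size (petit_val x))%N.
have le_xf : (skew_size (petit_val x) < skew_size f)%N by apply: petit_size.
have lt_d : (skew_size (skewX s ^+ d)%R < skew_size f)%N.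
  by rewrite skew_sizeXn -ltn_predRL -subn1 ltn_sub2l.
pose y := to_petit (skewX s ^+ d).
have nzx : petit_val x != 0 by rewrite -skew_size_gt0 ltnW.
have nzy : skewX s ^+ d != 0 by rewrite -skew_size_gt0 skew_sizeXn.
have szxy : skew_size (petit_val x * petit_val y) = skew_size f.
  by rewrite to_petitK // skew_sizeM // skew_sizeXn addnS /= subnKC // ltnW.
have [[q def_xy] lt_r] := skew_remP (petit_val x * petit_val y) nzf.
have /(associator_vanishesP def_xy lt_r)/(_ k) := nuc_x y.
have nzq : q != 0.
  apply: contraTneq lt_r => q0; move: def_xy; rewrite q0 mul0r add0r => <-.
  by rewrite szxy ltnn.
have /skew_size1P[c def_q] : (skew_size q <= 1)%N.
  have : (skew_size (q * f)%R <= skew_size f)%N.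
    have -> : q * f = petit_val x * petit_val y
      - skew_rem (petit_val x * petit_val y) f by rewrite {1}def_xy addrK.
    by apply: skew_sizeB; rewrite ?szxy // ltnW.
  by rewrite skew_sizeM // -ltnS prednK ?addn_gt0 ?skew_size_gt0 ?nzq //
    -add1n leq_add2r.
rewrite def_q -mulrA; apply: in_left_idealCM.
by apply: contraNneq nzq => c0; rewrite def_q c0 skewC0.
Qed.

End Petit.

Section PetitBinomial.

Variables (F : fieldType) (K : fieldExtType F) (s : {rmorphism K -> K}).
Variables (m : nat) (a : K).
Hypotheses (m_gt0 : (0 < m)%N) (nza : a != 0).

Let f : skewpoly s := skewX s ^+ m - skewC s a.

(** If i + j >= m, dividing the product b t^(i+j) by t^m - a leaves the quotient
    b t^e with e = i + j - m, because t^(e+m) = t^e (t^m - a) + s^e(a) t^e.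
    Vanishing of the associator gives b t^e f R <= R f, and cancelling b t^e
    makes f right-invariant. *)
Lemma associator_vanishes_monomial (x y : petit f) c d i j :
    ~ right_invariant f -> c != 0 -> d != 0 ->
    petit_val x = skewC s c * skewX s ^+ i ->
    petit_val y = skewC s d * skewX s ^+ j ->
  associator_vanishes x y -> (i + j < m)%N.
Proof.
move=> notRI nzc nzd val_x val_y xy0.
have nzf : f != 0 by apply: binomial_neq0.
have lt_i : (i < m)%N.
  have := petit_size nzf x.
  by rewrite val_x skew_size_monomial // skew_size_binomial.
have lt_j : (j < m)%N.
  have := petit_size nzf y.
  by rewrite val_y skew_size_monomial // skew_size_binomial.
rewrite ltnNge; apply/negP => le_m; apply: notRI => k.
pose e := (i + j - m)%N; pose b := c * iter i s d.
have nzb : b != 0 by rewrite mulf_neq0 // iter_skew_eq0.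
have def_xy : petit_val x * petit_val y
    = skewC s b * skewX s ^+ e * f + skewC s (b * iter e s a) * skewX s ^+ e.
  rewrite val_x val_y skew_monomialM -(subnK le_m) -/e -/b exprD /f mulrBr.
  by rewrite -[_ * skewC s a]mulrA skewXn_mulC skewCM_morph !mulrA subrK.
have lt_r :
    (skew_size (skewC s (b * iter e s a) * skewX s ^+ e)%R < skew_size f)%N.
  rewrite skew_size_monomial ?mulf_neq0 ?iter_skew_eq0 // skew_size_binomial //.
  rewrite ltnS /e ltn_subLR //.
  by rewrite (leq_trans _ (leq_add (ltnW lt_i) lt_j)) ?addnS.
have /(_ k) := (associator_vanishesP nzf def_xy lt_r).1 xy0.
by rewrite -[_ * f * k]mulrA => /(left_ideal_monomial_cancel m_gt0 nza nzb).
Qed.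

End PetitBinomial.

(** * Isomorphisms between algebras of binomials *)

Section Isomorphism.

Variables (F : fieldType) (K : fieldExtType F) (s1 s2 : {rmorphism K -> K}).
Variables (m : nat) (a1 a2 : K).
Hypotheses (m_gt1 : (1 < m)%N) (nza2 : a2 != 0).

Let f1 : skewpoly s1 := skewX s1 ^+ m - skewC s1 a1.
Let f2 : skewpoly s2 := skewX s2 ^+ m - skewC s2 a2.

Hypothesis notRI : ~ right_invariant f2.

Variable phi : {linear petit f1 -> petit f2}.
Hypotheses (phi_bij : bijective phi)
  (phiM : {morph phi : x y / petit_mul f1 x y >-> petit_mul f2 x y}).

Let m_gt0 : (0 < m)%N. Proof. exact: ltnW. Qed.
Let nzf1 : f1 != 0. Proof. exact: binomial_neq0. Qed.
Let nzf2 : f2 != 0. Proof. exact: binomial_neq0. Qed.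
Let size_f1 : skew_size f1 = m.+1. Proof. exact: skew_size_binomial. Qed.
Let size_f2 : skew_size f2 = m.+1. Proof. exact: skew_size_binomial. Qed.
Let lt_C a : (skew_size (skewC s1 a) < skew_size f1)%N.
Proof. by rewrite size_f1 (leq_ltn_trans (size_polyC_leq1 a)). Qed.

Lemma iso_associator x y : associator_vanishes x y ->
  associator_vanishes (phi x) (phi y).
Proof.
have [psi phiK psiK] := phi_bij => xy0 z.
by rewrite -(psiK z) -!phiM xy0.
Qed.

(** The constant term of the image; the image of a constant is itself a constant,
    so this is the restriction of phi to K. *)
Definition const_iso a : K :=
  (petit_val (phi (to_petit f1 (skewC s1 a))) : {poly K})`_0.

(** Constants lie in the left nucleus of A_1, and phi maps it into the left
    nucleus of A_2, which consists of constants. *)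
Lemma const_isoE a :
  petit_val (phi (to_petit f1 (skewC s1 a))) = skewC s2 (const_iso a).
Proof.
apply: size1_polyC; apply: left_nucleus_const => // [|y].
  by rewrite size_f2.
have [psi phiK psiK] := phi_bij; rewrite -(psiK y); apply: iso_associator.
apply: const_associator_vanishes; rewrite // to_petitK //.
exact: size_polyC_leq1.
Qed.

Lemma iso_val_inj x y : petit_val (phi x) = petit_val (phi y) -> x = y.
Proof. by move/petit_val_inj/(bij_inj phi_bij). Qed.


Lemma const_iso_linear : linear const_iso.
Proof.
move=> c a b; rewrite /const_iso.
have -> : to_petit f1 (skewC s1 (c *: a + b))
    = c *: to_petit f1 (skewC s1 a) + to_petit f1 (skewC s1 b).
  apply: petit_val_inj; rewrite petit_valD petit_valZ !to_petitK //.
  rewrite -skewCM_morph mulr_algl; exact: polyCD.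
by rewrite linearP petit_valD petit_valZ coefD coef_skewCM mulr_algl.
Qed.

Lemma iso_mul_small g h :
    (skew_size g < skew_size f1)%N -> (skew_size h < skew_size f1)%N ->
    (skew_size (g * h)%R < skew_size f1)%N ->
  petit_val (phi (to_petit f1 (g * h))) =
  skew_rem (petit_val (phi (to_petit f1 g)) *
            petit_val (phi (to_petit f1 h))) f2.
Proof.
by move=> lt_g lt_h lt_gh; rewrite -petit_mul_small // phiM petit_mulE.
Qed.

Lemma const_isoM a b : const_iso (a * b) = const_iso a * const_iso b.
Proof.
have := iso_mul_small (lt_C a) (lt_C b); rewrite -skewCM_morph lt_C => /(_ isT).
rewrite !const_isoE -skewCM_morph skew_rem_id //; first exact: polyC_inj.
by rewrite size_f2 (leq_ltn_trans (size_polyC_leq1 _)).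
Qed.

Lemma const_iso1 : const_iso 1 = 1.
Proof.
have nz1 : const_iso 1 != 0.
  apply: contraTneq isT => tau1; have := const_isoE 1; rewrite tau1.
  have -> : skewC s2 0 = petit_val (phi 0) by rewrite linear0 skewC0.
  move/iso_val_inj/(congr1 (@petit_val _ _ _ _)); rewrite to_petitK //.
  by move=> /eqP; rewrite polyC_eq0 oner_eq0.
by apply: (mulfI nz1); rewrite -const_isoM !mulr1.
Qed.

Let T : skewpoly s2 := petit_val (phi (to_petit f1 (skewX s1))).

Let lt_X : (skew_size (skewX s1) < skew_size f1)%N.
Proof. by rewrite size_f1 /skew_size size_polyX. Qed.

(** The image under phi of the commutation rule t c = s_1(c) t, compared
    coefficientwise. *)
Lemma iso_X_coef a i :
  (T : {poly K})`_i * iter i s2 (const_iso a)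
  = const_iso (s1 a) * (T : {poly K})`_i.
Proof.
have lt_XC : (skew_size (skewC s1 (s1 a) * skewX s1)%R < skew_size f1)%N.
  rewrite skewCM size_f1 (leq_ltn_trans (size_scale_leq _ _)) //.
  by rewrite size_polyX.
have := iso_mul_small (lt_C _) lt_X lt_XC.
rewrite -skewX_mulC; rewrite -skewX_mulC in lt_XC.
rewrite (iso_mul_small lt_X (lt_C a)) // !const_isoE -/T !skew_rem_id //.
- by move/(congr1 (fun p : {poly K} => p`_i)); rewrite coef_skewMC coef_skewCM.
- rewrite skewCM (leq_ltn_trans (size_scale_leq _ _)) //; exact: petit_size.
apply: leq_ltn_trans (petit_size nzf2 (phi (to_petit f1 (skewX s1)))).
by apply/leq_sizeP => j le_j; rewrite coef_skewMC nth_default ?mul0r.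
Qed.

Lemma iso_neq0 g : g != 0 -> (skew_size g < skew_size f1)%N ->
  petit_val (phi (to_petit f1 g)) != 0.
Proof.
move=> nzg lt_g; apply: contraNneq nzg => phig0.
have : petit_val (phi (to_petit f1 g)) = petit_val (phi 0).
  by rewrite linear0 phig0.
by move/iso_val_inj/(congr1 (@petit_val _ _ _ _)); rewrite to_petitK // => ->.
Qed.

Lemma iso_X_neq0 : T != 0.
Proof. by rewrite iso_neq0 // -skew_size_gt0 /skew_size size_polyX. Qed.

(** In A_1 the product t t^i needs no reduction while i + 1 < m, so its associator
    with every z vanishes.  Hence so does that of phi(t) = k t^j and
    phi(t^i) = c t^(i j), and their product needs no reduction either. *)
Lemma iso_X_monomial_degree k j :
  T = skewC s2 k * skewX s2 ^+ j -> (m.-1 * j < m)%N.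
Proof.
move=> def_T.
have nzk : k != 0.
  by apply: contraTneq iso_X_neq0 => k0; rewrite def_T k0 skewC0 mul0r eqxx.
have lt_Xn i : (i < m)%N -> (skew_size (skewX s1 ^+ i)%R < skew_size f1)%N.
  by rewrite skew_sizeXn size_f1.
suff /(_ m.-1) [|//] : forall i, (i < m)%N -> (i * j < m)%N /\
    exists2 c, c != 0 & petit_val (phi (to_petit f1 (skewX s1 ^+ i)))
                        = skewC s2 c * skewX s2 ^+ (i * j).
  by rewrite prednK.
elim=> [_|i IH lt_i1].
  split; rewrite mul0n //; exists 1; rewrite ?oner_neq0 // !expr0 mulr1.
  by rewrite [1](_ : _ = skewC s1 1) // const_isoE const_iso1.
have [lt_ij [c nzc phi_Xi]] := IH (ltnW lt_i1).
have lt_XXi : (skew_size (skewX s1 * skewX s1 ^+ i)%R < skew_size f1)%N.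
  by rewrite -exprS lt_Xn.
have lt_deg : (j + i * j < m)%N.
  apply: (associator_vanishes_monomial m_gt0 nza2 notRI nzk nzc def_T phi_Xi).
  apply: iso_associator; apply: associator_vanishes_small => //.
  by rewrite !to_petitK // lt_Xn // ltnW.
rewrite mulSn; split=> //; exists (k * iter j s2 c).
  by rewrite mulf_neq0 // iter_skew_eq0.
rewrite exprS iso_mul_small // ?lt_Xn 1?ltnW // phi_Xi -/T def_T.
rewrite skew_monomialM skew_rem_id // skew_size_monomial ?size_f2 ?ltnS //.
by rewrite mulf_neq0 // iter_skew_eq0.
Qed.

End Isomorphism.

(** * Galois-theoretic conclusion *)

Lemma field_hom_gal (F : fieldType) (K : splittingFieldType F) (tau : K -> K) :
    linear tau -> {morph tau : x y / x * y} -> tau 1 = 1 ->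
  exists2 g : gal_of {:K}, g \in 'Gal({:K} / 1%AS)%g & tau =1 g.
Proof.
move=> tauL tauM tau1.
pose tauLin : {linear K -> K} :=
  HB.pack tau (GRing.isLinear.Build _ _ _ _ tau tauL).
have hom_tau : kHom 1 {:K} (linfun tauLin).
  by rewrite k1HomE; apply/ahom_inP; split=> [x y _ _|]; rewrite !lfunE //.
have sub1K : (1%AS <= {:K}%AS <= {:K}%AS)%VS by rewrite sub1v subvv.
have [g gal_g tauE] := kHom_to_gal sub1K (normalFieldf 1) hom_tau.
by exists g => // x; rewrite -tauE ?memvf // lfunE.
Qed.

Lemma gal_iter (F : fieldType) (K : splittingFieldType F) (s : gal_of {:K})
    i (x : K) :
  iter i s x = (s ^+ i)%g x.
Proof.
elim: i => [|i IH]; first by rewrite expg0 gal_id.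
by rewrite expgSr galM ?memvf // -IH.
Qed.

Theorem theorem3p3 (F : fieldType) (K : splittingFieldType F) (n m : nat)
    (s1 s2 : gal_of {:K}) (a1 a2 : K) :
  galois 1%AS {:K} -> cyclic 'Gal({:K} / 1%AS) -> \dim {:K} = n ->
  (3 <= n)%N -> (1 < m)%N -> (m - 1 <= n)%N ->
  generator 'Gal({:K} / 1%AS) s1 -> generator 'Gal({:K} / 1%AS) s2 ->
  s1 != s2 ->
  a1 \notin 1%VS -> a2 \notin 1%VS ->
  ~ right_invariant (skewX s1 ^+ m - skewC s1 a1) ->
  ~ right_invariant (skewX s2 ^+ m - skewC s2 a2) ->
  ~ nalg_isomorphic (petit_mul (skewX s1 ^+ m - skewC s1 a1))
                    (petit_mul (skewX s2 ^+ m - skewC s2 a2)).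
Proof.
move=> galK cycK dimK n_ge3 m_gt1 le_mn gen1 gen2 neq_s12 Fa1 Fa2 _ notRI.
case=> phi [phi_bij phiM].
have nza2 : a2 != 0 by apply: contraNneq Fa2 => ->; apply: mem0v.
have ord_gen s : generator 'Gal({:K} / 1%AS) s -> #[s]%g = n.
  move=> /eqP gen_s; rewrite orderE -gen_s -galois_dim // dimv1 divn1.
  exact: dimK.
pose tau := const_iso phi.
have tauL : linear tau := const_iso_linear m_gt1 phi.
have tauM : {morph tau : x y / x * y} := const_isoM m_gt1 notRI phi_bij phiM.
have tau1 : tau 1 = 1 := const_iso1 m_gt1 notRI phi_bij phiM.
have [g gal_g tauE] := field_hom_gal tauL tauM tau1.
pose T : {poly K} := petit_val (phi (to_petit _ (skewX s1))).
have XT := iso_X_coef m_gt1 notRI phi_bij phiM.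
have support_T j : T`_j != 0 -> (s2 ^+ j)%g = s1.
  move=> nzTj; apply: (mulgI g).
  have -> : (g * s1 = s1 * g)%g.
    by apply: (centsP (cyclic_abelian cycK)); rewrite ?(eqP gen1) ?cycle_id //
      -(eqP gen1).
  apply/eqP/gal_eqP => x _; rewrite !galM ?memvf //.
  apply: (mulfI nzTj); by rewrite -gal_iter -!tauE XT mulrC.
have sizeT : (size T <= m)%N.
  rewrite -ltnS -(skew_size_binomial s2 a2 (ltnW m_gt1)).
  by apply: petit_size; apply: binomial_neq0; rewrite ltnW.
have lt_m j : T`_j != 0 -> (j < m)%N.
  move=> nzj; rewrite (leq_trans _ sizeT) // ltnNge.
  by apply: contra nzj => le_j; rewrite nth_default.
have s1_neq1 : s1 != 1%g.
  by apply: contraTneq n_ge3 => s1_1; rewrite -(ord_gen _ gen1) s1_1 order1.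
have lt_n j : T`_j != 0 -> (j < n)%N.
  (* Here j <= m - 1 <= n, and j = n would give s1 = s2^n = 1. *)
  move=> nzj; have le_jn : (j <= n)%N.
    apply: leq_trans le_mn.
    by rewrite subn1 -ltnS prednK; [apply: lt_m | apply: ltnW].
  rewrite ltn_neqAle le_jn andbT; apply: contraNneq s1_neq1 => eq_jn.
  by rewrite -(support_T j nzj) eq_jn -(ord_gen _ gen2) expg_order.
have T_uniq i j : T`_i != 0 -> T`_j != 0 -> i = j.
  move=> nzi nzj.
  have /eqP : (s2 ^+ i = s2 ^+ j)%g by rewrite !support_T.
  by rewrite eq_expg_mod_order (ord_gen _ gen2) !modn_small ?lt_n // => /eqP.
have nzT : T != 0 := iso_X_neq0 m_gt1 phi_bij.
pose j := (size T).-1.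
have nzj : T`_j != 0 by rewrite -lead_coefE lead_coef_eq0.
have def_T : T = skewC s2 T`_j * skewX s2 ^+ j.
  rewrite skew_monomialE; apply/polyP => i; rewrite coefZ coefXn.
  have [-> | neq_ij] := eqVneq i j; first by rewrite mulr1.
  by rewrite mulr0; apply/eqP/idPn => nzi; case/eqP: neq_ij; apply: T_uniq.
have := iso_X_monomial_degree m_gt1 nza2 notRI phi_bij phiM def_T.
have := support_T j nzj; case: (j) => [|[|i]].
- by move/esym/eqP; rewrite expg0 (negPf s1_neq1).
- by move/esym/eqP; rewrite expg1 (negPf neq_s12).
move=> _; case: (m) m_gt1 => [|[|k]] //= _; rewrite ltnNge => /negP; apply.
rewrite (@leq_trans (k.+1 * 2)) ?leq_mul2l // muln2 -addnn addnS ltnS.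
exact: leq_addr.
Qed.
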